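(* At each iteration $k\ge1$ of the PNT iteration, with $\Delta x_k=V_k\Delta y_k$, it holds that $$\nabla h(x_{k-1},\lambda_{k-1})^\top\begin{pmatrix}\Delta x_k\\ \Delta\lambda_k\end{pmatrix}=-2h(x_{k-1},\lambda_{k-1})\le0.$$
   Context: Problem setting. Let $m,n\ge1$, $A\in\mathbb{R}^{m\times n}$, $b\in\mathbb{R}^m$, and let $M\in\mathbb{R}^{m\times m}$, $N\in\mathbb{R}^{n\times n}$ be symmetric positive definite. For a symmetric positive definite matrix $B$, $\|x\|_B=(x^\top Bx)^{1/2}$. The real parameter $\tau>1$ is fixed. Standing assumption: for every minimizer $x$ of $\|Ax-b\|_{M^{-1}}$ over $\mathbb{R}^n$ one has $\|Ax-b\|_{M^{-1}}^2<\tau m<\|b\|_{M^{-1}}^2$. Define the merit function $$h(x,\lambda)=\tfrac12\left[\|\lambda A^\top M^{-1}(Ax-b)+N^{-1}x\|_N^2+\left(\tfrac12\|Ax-b\|_{M^{-1}}^2-\tfrac{\tau m}{2}\right)^2\right].$$ Generalized Golub-Kahan bidiagonalization (gen-GKB). Vectors $u_i\in\mathbb{R}^m$, $v_i\in\mathbb{R}^n$ and scalars $\alpha_i,\beta_i\ge0$ are generated by $\beta_1u_1=b$, $\alpha_iv_i=NA^\top M^{-1}u_i-\beta_iv_{i-1}$, $\beta_{i+1}u_{i+1}=Av_i-\alpha_iu_i$ ($i\ge1$), $v_0=0$, where $\alpha_i,\beta_i$ are such that $\|u_i\|_{M^{-1}}=\|v_i\|_{N^{-1}}=1$. The process stops as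 soon as some $\alpha_i$ or $\beta_i$ is zero; $k_t=\max\{k:\alpha_k\beta_k>0\}$. For $k\le k_t$ let $V_k=(v_1,\dots,v_k)$ and let $B_k\in\mathbb{R}^{(k+1)\times k}$ be the lower bidiagonal matrix with diagonal $\alpha_1,\dots,\alpha_k$ and subdiagonal $\beta_2,\dots,\beta_{k+1}$. For $k>k_t$, $V_k:=V_{k_t}$, $B_k:=B_{k_t}$; if $\beta_{k_t+1}=0$, $B_{k_t}$ is replaced by the square matrix of its first $k_t$ rows. $e_1$ is the first standard basis vector of dimension equal to the number of rows of $B_k$. Set $$F^{(k)}(y,\lambda)=\begin{pmatrix}\lambda B_k^\top(B_ky-\beta_1e_1)+y\\ \tfrac12\|B_ky-\beta_1e_1\|_2^2-\tfrac{\tau m}{2}\end{pmatrix},\quad J^{(k)}(y,\lambda)=\begin{pmatrix}\lambda B_k^\top B_k+I& B_k^\top(B_ky-\beta_1e_1)\\ (B_ky-\beta_1e_1)^\top B_k&0\end{pmatrix}.$$ PNT iteration. Fix constants $c,\eta\in(0,1)$ (defaults $c=10^{-4}$, $\eta=0.9$) and $\lambda_0>0$; $x_0=0$, $y_0$ is the empty vector. For $k=1,2,\dots$: put $\bar y_{k-1}=(y_{k-1}^\top,0)^\top\in\mathbb{R}^k$ if $k\le k_t$ and $\bar y_{k-1}=y_{k-1}$ if $k>k_t$ (so $\bar y_0=0\in\mathbb{R}$ and $x_{k-1}=V_k\bar y_{k-1}$). Compute the projected Newton direction $(\Delta y_k^\top,\Delta\lambda_k)^\top=-J^{(k)}(\bar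 y_{k-1},\lambda_{k-1})^{-1}F^{(k)}(\bar y_{k-1},\lambda_{k-1})$ (the matrix is nonsingular at every iteration) and $\Delta x_k=V_k\Delta y_k$. Let $\gamma_{\rm init}=1$ if $\Delta\lambda_k\ge0$ and $\gamma_{\rm init}=\min\{1,-\eta\lambda_{k-1}/\Delta\lambda_k\}$ if $\Delta\lambda_k<0$; let $\gamma_k=\eta^l\gamma_{\rm init}$ with the smallest integer $l\ge0$ such that the Armijo condition $h(x_{k-1}+\gamma_k\Delta x_k,\lambda_{k-1}+\gamma_k\Delta\lambda_k)\le h(x_{k-1},\lambda_{k-1})+c\gamma_k(\Delta x_k^\top,\Delta\lambda_k)\nabla h(x_{k-1},\lambda_{k-1})$ holds. Set $y_k=\bar y_{k-1}+\gamma_k\Delta y_k$, $\lambda_k=\lambda_{k-1}+\gamma_k\Delta\lambda_k$, $x_k=V_ky_k=x_{k-1}+\gamma_k\Delta x_k$. The method stops if $h(x_k,\lambda_k)=0$. *)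

(* Defs.v *)
From mathcomp Require Import all_boot all_order all_algebra.
From mathcomp Require Import all_classical all_reals all_analysis.
Import Order.TTheory GRing.Theory Num.Theory.
Import numFieldNormedType.Exports.

Set Implicit Arguments.
Unset Strict Implicit.
Unset Printing Implicit Defensive.

Local Open Scope ring_scope.

Section LinearAlgebra.
Context {R : realType}.

Definition spd p (B : 'M[R]_p) : Prop :=
  B^T = B /\ forall x : 'cV[R]_p, x != 0 -> 0 < (x^T *m B *m x) 0 0.

Definition wnorm p (B : 'M[R]_p) (x : 'cV[R]_p) : R :=
  Num.sqrt ((x^T *m B *m x) 0 0).

Definition norm2 p (x : 'cV[R]_p) : R := Num.sqrt (\sum_i x i 0 ^+ 2).

Definition e1 p : 'cV[R]_p := \col_i (i == 0 :> nat)%:R.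

(* If p <= q, appends q - p zeros to y. *)
Definition pad p q (y : 'cV[R]_p) : 'cV[R]_q :=
  \col_i (if insub (i : nat) is Some j then y j 0 else 0).

Definition gradient p (f : 'cV[R]_p -> R) (z : 'cV[R]_p) : 'cV[R]_p :=
  \col_i 'D_(delta_mx i 0 : 'cV[R]_p) f z.

End LinearAlgebra.

Section GolubKahan.
Context {R : realType} {m n : nat}.
Implicit Types (A : 'M[R]_(m, n)) (b : 'cV[R]_m) (M : 'M[R]_m) (N : 'M[R]_n).
Implicit Types (u : nat -> 'cV[R]_m) (v : nat -> 'cV[R]_n).
Implicit Types (alpha beta : nat -> R).

(* The sequences are 1-based, except for v 0 = 0; u 0, alpha 0 and beta 0 are
   unused.  A vector whose coefficient is zero cannot be normalized and is set
   to 0.  The equations then force all later coefficients and vectors to be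
   zero, so that the nonzero part of the sequences is exactly what is generated
   before the process stops. *)
Record gen_GKB A b M N u v alpha beta : Prop := GenGKB {
  gkb_v0 : v 0%N = 0;
  gkb_alpha_ge0 : forall i, (1 <= i)%N -> 0 <= alpha i;
  gkb_beta_ge0 : forall i, (1 <= i)%N -> 0 <= beta i;
  gkb_init : beta 1%N *: u 1%N = b;
  gkb_stepv : forall i, (1 <= i)%N ->
    alpha i *: v i = N *m A^T *m invmx M *m u i - beta i *: v i.-1;
  gkb_stepu : forall i, (1 <= i)%N ->
    beta i.+1 *: u i.+1 = A *m v i - alpha i *: u i;
  gkb_normu : forall i, (1 <= i)%N -> beta i != 0 -> wnorm (invmx M) (u i) = 1;
  gkb_normv : forall i, (1 <= i)%N -> alpha i != 0 -> wnorm (invmx N) (v i) = 1;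
  gkb_stopu : forall i, (1 <= i)%N -> beta i = 0 -> u i = 0;
  gkb_stopv : forall i, (1 <= i)%N -> alpha i = 0 -> v i = 0
}.

(* kt = max {k >= 1 : alpha_k beta_k > 0} *)
Definition gkb_terminates_at alpha beta (kt : nat) : Prop :=
  [/\ (1 <= kt)%N, 0 < alpha kt * beta kt &
      forall k, (1 <= k)%N -> 0 < alpha k * beta k -> (k <= kt)%N].

(* Number of columns of V_k and B_k. *)
Definition gkb_cols (kt k : nat) : nat := minn k kt.

(* Number of rows of B_k; the last row of the (kt+1) x kt matrix is dropped when
   it is zero. *)
Definition gkb_rows beta (kt k : nat) : nat :=
  if (kt <= k)%N && (beta kt.+1 == 0) then kt else (gkb_cols kt k).+1.

Definition gkb_V v p : 'M[R]_(n, p) := \matrix_(i, j) v j.+1 i 0.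

(* Matrix indices are 0-based: entry (j, j) is alpha_(j+1), entry (j+1, j) is
   beta_(j+2). *)
Definition gkb_B alpha beta q p : 'M[R]_(q, p) :=
  \matrix_(i, j) (if i == j :> nat then alpha j.+1
                  else if i == j.+1 :> nat then beta j.+2 else 0).

End GolubKahan.

Section ProjectedNewton.
Context {R : realType}.

Definition projF (tau beta1 : R) (m : nat) q p (B : 'M[R]_(q, p))
    (y : 'cV[R]_p) (lambda : R) : 'cV[R]_(p + 1) :=
  let r := B *m y - beta1 *: e1 q in
  col_mx (lambda *: (B^T *m r) + y)
         (2^-1 * norm2 r ^+ 2 - tau * m%:R / 2)%:M.

Definition projJ (beta1 : R) q p (B : 'M[R]_(q, p))
    (y : 'cV[R]_p) (lambda : R) : 'M[R]_(p + 1) :=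
  let r := B *m y - beta1 *: e1 q in
  block_mx (lambda *: (B^T *m B) + 1%:M) (B^T *m r)
           (r^T *m B)                    0.

End ProjectedNewton.

Section PNT.
Context {R : realType} {m n : nat}.
Variables (A : 'M[R]_(m, n)) (b : 'cV[R]_m) (M : 'M[R]_m) (N : 'M[R]_n).
Variable tau : R.

Definition merit (x : 'cV[R]_n) (lambda : R) : R :=
  2^-1 * (wnorm N (lambda *: (A^T *m invmx M *m (A *m x - b)) + invmx N *m x)
            ^+ 2
          + (2^-1 * wnorm (invmx M) (A *m x - b) ^+ 2 - tau * m%:R / 2) ^+ 2).

(* Gradient with respect to all n + 1 variables (x, lambda). *)
Definition grad_merit (x : 'cV[R]_n) (lambda : R) : 'cV[R]_(n + 1) :=
  gradient (fun z : 'cV[R]_(n + 1) => merit (usubmx z) (dsubmx z 0 0))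
           (col_mx x lambda%:M).

Definition merit_slope (x : 'cV[R]_n) (lambda : R) (dx : 'cV[R]_n) (dlambda : R)
  : R := ((grad_merit x lambda)^T *m col_mx dx dlambda%:M) 0 0.

Definition discrepancy_assumption : Prop :=
  forall x : 'cV[R]_n,
    (forall z : 'cV[R]_n,
       wnorm (invmx M) (A *m x - b) <= wnorm (invmx M) (A *m z - b)) ->
    wnorm (invmx M) (A *m x - b) ^+ 2 < tau * m%:R /\
    tau * m%:R < wnorm (invmx M) b ^+ 2.

Definition armijo (c : R) (x dx : 'cV[R]_n) (lambda dlambda gamma : R) : Prop :=
  merit (x + gamma *: dx) (lambda + gamma * dlambda)
    <= merit x lambda + c * gamma * merit_slope x lambda dx dlambda.

Definition gamma_init (eta lambda dlambda : R) : R :=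
  if 0 <= dlambda then 1 else Num.min 1 (- eta * lambda / dlambda).

Definition backtracking (c eta : R) (x dx : 'cV[R]_n)
    (lambda dlambda gamma : R) : Prop :=
  exists l : nat,
    [/\ gamma = eta ^+ l * gamma_init eta lambda dlambda,
        armijo c x dx lambda dlambda gamma &
        forall l' : nat, (l' < l)%N ->
          ~ armijo c x dx lambda dlambda
              (eta ^+ l' * gamma_init eta lambda dlambda)].

Definition pnt_x (v : nat -> 'cV[R]_n) (kt : nat)
    (y : forall k, 'cV[R]_(gkb_cols kt k)) (k : nat) : 'cV[R]_n :=
  gkb_V v (gkb_cols kt k) *m y k.

Definition pnt_dx (v : nat -> 'cV[R]_n) (kt : nat)
    (dy : forall k, 'cV[R]_(gkb_cols kt k)) (k : nat) : 'cV[R]_n :=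
  gkb_V v (gkb_cols kt k) *m dy k.

(* The vector ybar_(k-1): y_(k-1) with a zero appended when k <= kt, and y_(k-1)
   itself when k > kt. *)
Definition pnt_ybar (kt : nat) (y : forall k, 'cV[R]_(gkb_cols kt k)) (k : nat)
  : 'cV[R]_(gkb_cols kt k) := pad (gkb_cols kt k) (y k.-1).

(* The run has reached iteration K: iterations 1, ..., K - 1 are complete and
   none of them met the stopping criterion, and the projected Newton direction
   of iteration K is computed.  y 0 is the empty vector, since
   gkb_cols kt 0 = 0. *)
Record PNT_run (c eta lambda0 : R) (v : nat -> 'cV[R]_n)
    (alpha beta : nat -> R) (kt : nat)
    (y dy : forall k, 'cV[R]_(gkb_cols kt k)) (lambda dlambda gamma : nat -> R)
    (K : nat) : Prop := PNTRun {
  pnt_lambda0 : lambda 0%N = lambda0;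
  pnt_direction : forall k, (1 <= k <= K)%N ->
    let B := gkb_B alpha beta (gkb_rows beta kt k) (gkb_cols kt k) in
    col_mx (dy k) (dlambda k)%:M =
      - (invmx (projJ (beta 1%N) B (pnt_ybar y k) (lambda k.-1))
           *m projF tau (beta 1%N) m B (pnt_ybar y k) (lambda k.-1));
  pnt_gamma : forall k, (1 <= k < K)%N ->
    backtracking c eta (pnt_x v y k.-1) (pnt_dx v dy k)
      (lambda k.-1) (dlambda k) (gamma k);
  pnt_y : forall k, (1 <= k < K)%N ->
    y k = pnt_ybar y k + gamma k *: dy k;
  pnt_lambda : forall k, (1 <= k < K)%N ->
    lambda k = lambda k.-1 + gamma k * dlambda k;
  pnt_continue : forall k, (1 <= k < K)%N -> merit (pnt_x v y k) (lambda k) != 0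
}.

End PNT.

(* Main.v *)
Require Import Defs.
From mathcomp Require Import all_boot all_order all_algebra.
From mathcomp Require Import all_classical all_reals all_analysis.
From mathcomp Require Import ring lra.
Import Order.TTheory GRing.Theory Num.Theory.
Import numFieldNormedType.Exports.
Local Open Scope ring_scope.

(* Write x = V y, r = B y - beta_1 e_1, g = B^T r, s = A^T M^-1 (A x - b),
   w = lambda s + N^-1 x, d = (|A x - b|^2 - tau m) / 2, so that
   2 h = w^T N w + d^2.  The bidiagonalization gives N s = V g: the last entry
   of r vanishes before termination because y ends with a zero, and
   alpha_(kt+1) = 0 afterwards.  Hence N w = V (lambda g + y) stays in the
   subspace, and pairing the two blocks of the projected Newton equation with
   lambda g + y and d gives the slope -(w^T N w + d^2).

   This needs J to be invertible (invmx of a singular matrix is the matrix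
   itself), i.e. lambda > 0 and g <> 0.  If g = 0 then x is a least-squares
   solution, hence d < 0 and tau m < |b|^2 by the standing assumption.  But
   d >= 0 along the iteration: it holds at x = 0, and d is convex with
   linearization (1 - gamma) d in the step length gamma <= 1. *)
Set Implicit Arguments.
Unset Strict Implicit.

(** * Weighted bilinear forms and positive definite matrices *)

Definition bform (R : realType) p (B : 'M[R]_p) (x y : 'cV[R]_p) : R :=
  (x^T *m B *m y) 0 0.

Section BilinearForm.
Context {R : realType} {p : nat} (B : 'M[R]_p).

Lemma bformDl x y z : bform B (x + y) z = bform B x z + bform B y z.
Proof. by rewrite /bform linearD /= !mulmxDl mxE. Qed.

Lemma bformDr x y z : bform B x (y + z) = bform B x y + bform B x z.
Proof. by rewrite /bform mulmxDr mxE. Qed.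

Lemma bformZl c x y : bform B (c *: x) y = c * bform B x y.
Proof. by rewrite /bform linearZ /= -!scalemxAl mxE. Qed.

Lemma bformZr c x y : bform B x (c *: y) = c * bform B x y.
Proof. by rewrite /bform -scalemxAr mxE. Qed.

Lemma bform0l y : bform B 0 y = 0.
Proof. by rewrite -(scale0r (0 : 'cV_p)) bformZl mul0r. Qed.

Lemma bform0r x : bform B x 0 = 0.
Proof. by rewrite -(scale0r (0 : 'cV_p)) bformZr mul0r. Qed.

Lemma bformC x y : B^T = B -> bform B x y = bform B y x.
Proof.
move=> sB; rewrite /bform; have -> : x^T *m B *m y = (y^T *m B *m x)^T.
  by rewrite !trmx_mul trmxK sB mulmxA.
by rewrite mxE.
Qed.

Lemma bform_ge0 x : spd B -> 0 <= bform B x x.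
Proof.
move=> [_ pB]; have [->|/pB/ltW //] := eqVneq x 0.
by rewrite bform0l.
Qed.

Lemma bform_eq0 x : spd B -> bform B x x = 0 -> x = 0.
Proof.
by move=> [_ pB] x0; apply/eqP; apply: contra_eqT x0 => /pB/lt0r_neq0.
Qed.

Lemma wnormE x : wnorm B x = Num.sqrt (bform B x x).
Proof. by []. Qed.

Lemma sqr_wnorm x : spd B -> wnorm B x ^+ 2 = bform B x x.
Proof. by move=> hB; rewrite wnormE sqr_sqrtr // bform_ge0. Qed.

End BilinearForm.

Lemma bform1 (R : realType) p (x y : 'cV[R]_p) :
  bform 1%:M x y = (x^T *m y) 0 0.
Proof. by rewrite /bform mulmx1. Qed.

Lemma bform_mull (R : realType) p q (B : 'M[R]_p) (C : 'M[R]_(p, q)) x y :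
  bform B (C *m x) y = (x^T *m (C^T *m B *m y)) 0 0.
Proof. by rewrite /bform trmx_mul !mulmxA. Qed.

Lemma spd_id (R : realType) p : spd (1%:M : 'M[R]_p).
Proof.
split=> [|x]; first exact: trmx1.
apply: contra_neqT; rewrite mulmx1 -leNgt mxE => h.
have ge0 i : 0 <= x^T 0 i * x i 0 by rewrite mxE -expr2 sqr_ge0.
have /eqP : \sum_i x^T 0 i * x i 0 = 0.
  by apply/eqP; rewrite eq_le h sumr_ge0.
rewrite psumr_eq0 // => /allP h0; apply/colP => i.
have := h0 i (mem_index_enum i); rewrite /= !mxE mulf_eq0 orbb.
by move/eqP.
Qed.

Lemma sqr_norm2 (R : realType) p (x : 'cV[R]_p) :
  norm2 x ^+ 2 = bform 1%:M x x.
Proof.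
rewrite sqr_sqrtr ?sumr_ge0 // => [|i _]; last exact: sqr_ge0.
by rewrite bform1 mxE; apply: eq_bigr => i _; rewrite mxE.
Qed.

Lemma unitmx_inj_mul (R : realType) p (B : 'M[R]_p) :
  (forall x : 'cV_p, B *m x = 0 -> x = 0) -> B \in unitmx.
Proof.
move=> h; rewrite -unitmx_tr -row_free_unit; apply: inj_row_free => x.
move/(congr1 trmx); rewrite trmx_mul trmxK trmx0 => /h/(congr1 trmx).
by rewrite trmxK trmx0.
Qed.

Lemma spd_unit (R : realType) p (B : 'M[R]_p) : spd B -> B \in unitmx.
Proof.
move=> hB; apply: unitmx_inj_mul => x Bx0; apply: (bform_eq0 hB).
by rewrite /bform -mulmxA Bx0 mulmx0 mxE.
Qed.

Lemma spd_inv (R : realType) p (B : 'M[R]_p) : spd B -> spd (invmx B).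
Proof.
move=> hB; have uB := spd_unit hB; case: (hB) => sB pB.
split=> [|x x0]; first by rewrite trmx_inv sB.
have -> : x^T *m invmx B *m x = (invmx B *m x)^T *m B *m (invmx B *m x).
  by rewrite trmx_mul trmx_inv sB -!mulmxA (mulmxA B) mulmxV // mul1mx.
apply: pB; apply: contraNneq x0 => Bx0.
by rewrite -[x]mul1mx -(mulmxV uB) -mulmxA Bx0 mulmx0.
Qed.

(** * The gradient of the merit function *)

Lemma derive_polynomial (R : realType) p (f : 'cV[R]_p -> R) (a v : 'cV[R]_p)
    (c l : R) (q : {poly R}) :
  (forall t : R, f (t *: v + a) = c + t * l + t ^+ 2 * q.[t]) ->
  'D_v f a = l.
Proof.
move=> hf; apply: cvg_lim => //.
have fa : f a = c by have := hf 0; rewrite scale0r add0r => ->; ring.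
(* For t <> 0 the difference quotient equals P(t) = l + t q(t), a polynomial with value l at 0. *)
set P := l%:P + 'X * q.
have Pl : P.[0] = l by rewrite hornerD hornerC hornerM hornerX mul0r addr0.
have hq : (horner P t @[t --> (0 : R)^'] --> (P.[0] : R))%classic.
  by apply: cvg_within_filter; exact: continuous_horner.
rewrite -Pl; apply: cvg_trans hq; apply: near_eq_cvg; near=> t.
have t0 : t != 0 by near: t; exact: nbhs_dnbhs_neq.
rewrite /= hf fa !hornerE /GRing.scale /=; field.
by [].
Unshelve. all: by end_near.
Qed.

Lemma gradientP (R : realType) p (f : 'cV[R]_p -> R) (a : 'cV[R]_p)
    (G : 'rV[R]_p) :
  (forall v, 'D_v f a = (G *m v) 0 0) -> (gradient f a)^T = G.
Proof.
by move=> h; apply/rowP => i; rewrite !mxE h -colE mxE.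
Qed.

Section MeritGradient.
Context {R : realType} {m n : nat}.
Variables (A : 'M[R]_(m, n)) (b : 'cV[R]_m) (M : 'M[R]_m) (N : 'M[R]_n).
Variable tau : R.
Hypotheses (hM : spd M) (hN : spd N).

(** The gradient of |A x - b|^2 / 2 in the M^-1 norm; [stationarity] is then the x-gradient of
    lambda |A x - b|^2 / 2 + |x|^2 / 2, with |x| the N^-1 norm. *)
Definition normal_residual (x : 'cV[R]_n) : 'cV[R]_n :=
  A^T *m invmx M *m (A *m x - b).

Definition stationarity (x : 'cV[R]_n) (lambda : R) : 'cV[R]_n :=
  lambda *: normal_residual x + invmx N *m x.

Definition discrepancy (x : 'cV[R]_n) : R :=
  2^-1 * bform (invmx M) (A *m x - b) (A *m x - b) - tau * m%:R / 2.

Lemma meritE x lambda :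
  merit A b M N tau x lambda =
  2^-1 * (bform N (stationarity x lambda) (stationarity x lambda)
          + discrepancy x ^+ 2).
Proof. by rewrite /merit (sqr_wnorm _ hN) (sqr_wnorm _ (spd_inv hM)). Qed.

Lemma merit_ge0 x lambda : 0 <= merit A b M N tau x lambda.
Proof.
rewrite meritE mulr_ge0 ?invr_ge0 ?ler0n // addr_ge0 ?sqr_ge0 //.
exact: bform_ge0.
Qed.

Lemma residual_shift x dx t :
  A *m (t *: dx + x) - b = (A *m x - b) + t *: (A *m dx).
Proof. by rewrite mulmxDr -scalemxAr -addrA addrC. Qed.

Lemma stationarity_shift x dx (lambda dlambda t : R) :
  let s' := A^T *m invmx M *m (A *m dx) in
  stationarity (t *: dx + x) (t * dlambda + lambda) =
  stationarity x lambda
  + t *: (lambda *: s' + invmx N *m dx + dlambda *: normal_residual x)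
  + t ^+ 2 *: (dlambda *: s').
Proof.
move=> s'; rewrite /stationarity {1}/normal_residual residual_shift.
rewrite mulmxDr -scalemxAr -/s' -/(normal_residual x) mulmxDr -scalemxAr.
by apply/colP => i; rewrite !mxE; ring.
Qed.

Lemma discrepancy_shift x dx t :
  discrepancy (t *: dx + x) =
  discrepancy x + t * bform (invmx M) (A *m x - b) (A *m dx)
  + t ^+ 2 * (2^-1 * bform (invmx M) (A *m dx) (A *m dx)).
Proof.
rewrite /discrepancy residual_shift; move: (A *m x - b) => r.
rewrite !(bformDl, bformDr, bformZl, bformZr).
rewrite (@bformC _ _ _ (A *m dx) r); last by case: (spd_inv hM).
by field.
Qed.

Lemma derive_merit x (lambda : R) (v : 'cV[R]_(n + 1)) :
  let dx := usubmx v in let dlambda := dsubmx v 0 0 in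
  'D_v (fun z : 'cV[R]_(n + 1) =>
          merit A b M N tau (usubmx z) (dsubmx z 0 0)) (col_mx x lambda%:M) =
  bform N (stationarity x lambda)
    (lambda *: (A^T *m invmx M *m (A *m dx)) + invmx N *m dx
     + dlambda *: normal_residual x)
  + discrepancy x * bform (invmx M) (A *m x - b) (A *m dx).
Proof.
move=> dx dl.
set w := stationarity x lambda.
set w1 := lambda *: _ + _ + _.
set w2 := dl *: (A^T *m invmx M *m (A *m dx)).
set d := discrepancy x.
set d1 := bform (invmx M) (A *m x - b) (A *m dx).
set d2 := 2^-1 * bform (invmx M) (A *m dx) (A *m dx).
(* Along the line the two terms of the merit function are the squares of w + t w1 + t^2 w2 and d + t
   d1 + t^2 d2; the polynomial collects the coefficients of t^2, t^3 and t^4 in half their sum. *)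
apply: (@derive_polynomial _ _ _ _ _ (merit A b M N tau x lambda) _
  ((2^-1 * (bform N w1 w1 + 2 * bform N w w2 + d1 ^+ 2 + 2 * d * d2))%:P
   + (bform N w1 w2 + d1 * d2)%:P * 'X
   + (2^-1 * (bform N w2 w2 + d2 ^+ 2))%:P * 'X^2)) => t.
rewrite !linearD !linearZ /= !col_mxKu !col_mxKd.
have -> : (t *: dsubmx v + lambda%:M) 0 0 = t * dl + lambda.
  by rewrite /dl !mxE /= mulr1n.
rewrite !meritE stationarity_shift discrepancy_shift.
rewrite -/dx -/w -/w1 -/w2 -/d -/d1 -/d2.
clearbody w w1 w2 d d1 d2.
rewrite !(hornerD, hornerM, hornerC, hornerX, hornerXn).
rewrite !(bformDl, bformDr, bformZl, bformZr).
have sN : N^T = N by case: hN.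
rewrite (bformC w1 w sN) (bformC w2 w sN) (bformC w2 w1 sN).
by field.
Qed.

Lemma merit_slopeE x lambda dx dlambda :
  merit_slope A b M N tau x lambda dx dlambda =
  bform N (stationarity x lambda)
    (lambda *: (A^T *m invmx M *m (A *m dx)) + invmx N *m dx
     + dlambda *: normal_residual x)
  + discrepancy x * bform (invmx M) (A *m x - b) (A *m dx).
Proof.
set w := stationarity x lambda.
(* The row vector representing [derive_merit] as a linear form in the direction: its left block
   collects the terms in dx, its right block those in dlambda. *)
pose G : 'rV[R]_(n + 1) :=
  row_mx (w^T *m N *m (lambda *: (A^T *m invmx M *m A) + invmx N)
          + discrepancy x *: ((A *m x - b)^T *m invmx M *m A))
         (w^T *m N *m normal_residual x).
have addE (X Y : 'M[R]_1) : (X + Y) 0 0 = X 0 0 + Y 0 0 by rewrite mxE.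
have scaleE k (X : 'M[R]_1) : (k *: X) 0 0 = k * X 0 0 by rewrite mxE.
have GE dz dl : (G *m col_mx dz dl%:M) 0 0 =
  bform N w (lambda *: (A^T *m invmx M *m (A *m dz)) + invmx N *m dz
             + dl *: normal_residual x)
  + discrepancy x * bform (invmx M) (A *m x - b) (A *m dz).
  rewrite mul_row_col mul_mx_scalar mulmxDr -scalemxAr !mulmxDl -!scalemxAl.
  rewrite !bformDr !bformZr /bform !mulmxA !(addE, scaleE); ring.
rewrite /merit_slope /grad_merit (@gradientP _ _ _ _ G) => [|v].
  exact: GE.
rewrite derive_merit -GE; congr ((G *m _) 0 0).
by rewrite -mx11_scalar vsubmxK.
Qed.

End MeritGradient.

(** * Orthogonality and matrix relations of the bidiagonalization *)

Lemma sum_pick (R : realType) q (F G : nat -> R) c :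
  \sum_(i < q) F i * (if i == c :> nat then G i else 0) =
  if (c < q)%N then F c * G c else 0.
Proof.
under eq_bigr do rewrite (fun_if ( *%R _)) mulr0.
rewrite -big_mkcond; case: ltnP => [cq|qc].
  by rewrite (big_pred1 (Ordinal cq)).
by rewrite big_pred0 // => i; apply/negbTE; rewrite ltn_eqF // (leq_trans _ qc).
Qed.

(** The two cases exclude each other, so the nested conditional is a sum, and sums against B split
    into one [sum_pick] per diagonal. *)
Lemma gkb_BE (R : realType) (alpha beta : nat -> R) q p (i : 'I_q) (j : 'I_p) :
  gkb_B alpha beta q p i j =
  (if i == j :> nat then alpha j.+1 else 0)
  + (if i == j.+1 :> nat then beta j.+2 else 0).
Proof.
rewrite mxE; case: eqVneq => [->|_]; last by rewrite add0r.
by rewrite -[X in X == _]addn0 -addn1 eqn_add2l addr0.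
Qed.

Section GolubKahanTheory.
Context {R : realType} {m n : nat}.
Variables (A : 'M[R]_(m, n)) (b : 'cV[R]_m) (M : 'M[R]_m) (N : 'M[R]_n).
Variables (u : nat -> 'cV[R]_m) (v : nat -> 'cV[R]_n) (alpha beta : nat -> R).
Hypotheses (hM : spd M) (hN : spd N).
Hypothesis hgkb : gen_GKB A b M N u v alpha beta.

Local Notation dotM := (bform (invmx M)).
Local Notation dotN := (bform (invmx N)).

Lemma gkb_AE i : (1 <= i)%N -> A *m v i = beta i.+1 *: u i.+1 + alpha i *: u i.
Proof. by move=> i1; rewrite (gkb_stepu hgkb i1) subrK. Qed.

Lemma gkb_ATE i : (1 <= i)%N ->
  N *m A^T *m invmx M *m u i = alpha i *: v i + beta i *: v i.-1.
Proof. by move=> i1; rewrite (gkb_stepv hgkb i1) subrK. Qed.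

(** N A^T M^-1 is the adjoint of A between the N^-1 and M^-1 inner products, so the process is
    ordinary Golub-Kahan in these. *)
Lemma gkb_adjoint x z : dotM (A *m x) z = dotN x (N *m A^T *m invmx M *m z).
Proof.
rewrite bform_mull /bform -!mulmxA; congr ((_ *m _) 0 0).
by rewrite !mulmxA mulVmx ?mul1mx //; exact: spd_unit.
Qed.

Lemma dotMC x y : dotM x y = dotM y x.
Proof. by apply: bformC; case: (spd_inv hM). Qed.

Lemma dotNC x y : dotN x y = dotN y x.
Proof. by apply: bformC; case: (spd_inv hN). Qed.

Lemma gkb_dotu i : (1 <= i)%N -> beta i != 0 -> dotM (u i) (u i) = 1.
Proof.
move=> i1 bi; rewrite -(sqr_wnorm _ (spd_inv hM)).
by rewrite (gkb_normu hgkb i1 bi) expr1n.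
Qed.

Lemma gkb_dotv i : (1 <= i)%N -> alpha i != 0 -> dotN (v i) (v i) = 1.
Proof.
move=> i1 ai; rewrite -(sqr_wnorm _ (spd_inv hN)).
by rewrite (gkb_normv hgkb i1 ai) expr1n.
Qed.

(** Breakdown propagates: if beta_i = 0 then u_i = 0 and the recurrence reads alpha_i v_i = 0, which
    a unit v_i excludes. *)
Lemma gkb_beta_neq0 i : (1 <= i)%N -> alpha i != 0 -> beta i != 0.
Proof.
move=> i1 ai; apply: contraNneq ai => bi.
have := gkb_stepv hgkb i1; rewrite (gkb_stopu hgkb i1 bi) bi scale0r subr0.
rewrite mulmx0 => /eqP; rewrite scaler_eq0 => /orP[//|/eqP vi].
apply/negPn/negP => /(gkb_dotv i1); rewrite vi bform0l => /eqP.
by rewrite eq_sym oner_eq0.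
Qed.

Lemma gkb_alpha_neq0 i : (1 <= i)%N -> beta i.+1 != 0 -> alpha i != 0.
Proof.
move=> i1 bi; apply: contraNneq bi => ai.
have := gkb_stepu hgkb i1; rewrite (gkb_stopv hgkb i1 ai) ai scale0r subr0.
rewrite mulmx0 => /eqP; rewrite scaler_eq0 => /orP[//|/eqP ui].
apply/negPn/negP => /(@gkb_dotu i.+1 isT); rewrite ui bform0l => /eqP.
by rewrite eq_sym oner_eq0.
Qed.

(** Strong induction on the larger index, first for u, then for v. The new vector times its
    coefficient is replaced by its recurrence, and A is moved across by adjointness. All products
    vanish by induction except at the preceding index, where two equal terms cancel. A zero
    coefficient makes the vector zero. *)
Lemma gkb_orthogonal i j : (1 <= j < i)%N ->
  dotM (u i) (u j) = 0 /\ dotN (v i) (v j) = 0.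
Proof.
elim/ltn_ind: i j => -[|k] IH j /andP[j1 jk]; first by rewrite ltn0 in jk.
have k1 : (1 <= k)%N by exact: leq_trans j1 _.
(* The range includes l = 0, since expanding the recurrence at index 1 brings in v 0 = 0. *)
have Hv i l : (l < i <= k)%N -> dotN (v i) (v l) = 0.
  case/andP; case: l => [|l] li ik; first by rewrite (gkb_v0 hgkb) bform0r.
  by case: (IH i _ l.+1).
have ukj l : (1 <= l <= k)%N -> dotM (u k.+1) (u l) = 0.
  move=> /andP[l1 lk].
  have [bk|bk] := eqVneq (beta k.+1) 0.
    by rewrite (gkb_stopu hgkb _ bk) // bform0l.
  apply: (mulfI bk); rewrite mulr0 -bformZl (gkb_stepu hgkb k1).
  rewrite bformDl gkb_adjoint (gkb_ATE l1) -scaleNr bformZl.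
  rewrite bformDr !bformZr (Hv k l.-1) ?prednK ?leqnn ?lk // mulr0 addr0.
  move: lk; rewrite leq_eqVlt => /predU1P[->|lk].
    have ak := gkb_alpha_neq0 k1 bk.
    rewrite (gkb_dotv k1 ak) (gkb_dotu k1 (gkb_beta_neq0 k1 ak)).
    by rewrite mulNr subrr.
  rewrite Hv ?lk ?leqnn //; case: (IH k _ l); rewrite ?l1 ?lk // => -> _.
  by rewrite !mulr0 addr0.
split; first by apply: ukj; rewrite j1.
have [ak|ak] := eqVneq (alpha k.+1) 0.
  by rewrite (gkb_stopv hgkb _ ak) // bform0l.
have bk := gkb_beta_neq0 (isT : (1 <= k.+1)%N) ak.
apply: (mulfI ak); rewrite mulr0 -bformZl (gkb_stepv hgkb) //=.
rewrite bformDl dotNC -gkb_adjoint (gkb_AE j1) -scaleNr bformZl.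
rewrite dotMC bformDr !bformZr (ukj j) ?j1 // mulr0 addr0.
move: jk; rewrite ltnS leq_eqVlt => /predU1P[->|jk].
  rewrite (gkb_dotu _ bk) // (gkb_dotv k1 (gkb_alpha_neq0 k1 bk)).
  by rewrite mulNr subrr.
by rewrite ukj // Hv ?jk ?leqnn // !mulr0 addr0.
Qed.

Lemma gkb_beta_neq0_le i j : (1 <= i <= j)%N -> beta j != 0 -> beta i != 0.
Proof.
case/andP=> i1; elim: j => [|j IH]; first by rewrite leqNgt i1.
rewrite leq_eqVlt => /predU1P[-> //|ij] bj; apply: IH => //.
have j1 : (1 <= j)%N by exact: (leq_trans i1 ij).
exact/(gkb_beta_neq0 j1)/gkb_alpha_neq0.
Qed.

Definition gkb_U q : 'M[R]_(m, q) := \matrix_(i, j) u j.+1 i 0.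

Lemma col_gkb_U q (i : 'I_q) : col i (gkb_U q) = u i.+1.
Proof. by apply/colP => l; rewrite !mxE. Qed.

Lemma col_gkb_V q (i : 'I_q) : col i (gkb_V v q) = v i.+1.
Proof. by apply/colP => l; rewrite !mxE. Qed.

Lemma gram_mxE p q (B : 'M[R]_p) (W : 'M[R]_(p, q)) i j :
  (W^T *m B *m W) i j = bform B (col i W) (col j W).
Proof.
by rewrite /bform tr_col -row_mul !mxE; apply: eq_bigr => l _; rewrite !mxE.
Qed.

Lemma gkb_gramU q : (forall i, (1 <= i <= q)%N -> beta i != 0) ->
  (gkb_U q)^T *m invmx M *m gkb_U q = 1%:M.
Proof.
move=> hb; apply/matrixP => i j; rewrite gram_mxE !col_gkb_U mxE.
have [<-|] := eqVneq i j; first by rewrite gkb_dotu // hb //=.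
rewrite neq_ltn => /orP[] ij; last by case: (@gkb_orthogonal i.+1 j.+1).
by rewrite dotMC; case: (@gkb_orthogonal j.+1 i.+1).
Qed.

Lemma gkb_gramV p : (forall i, (1 <= i <= p)%N -> alpha i != 0) ->
  (gkb_V v p)^T *m invmx N *m gkb_V v p = 1%:M.
Proof.
move=> ha; apply/matrixP => i j; rewrite gram_mxE !col_gkb_V mxE.
have [<-|] := eqVneq i j; first by rewrite gkb_dotv // ha //=.
rewrite neq_ltn => /orP[] ij; last by case: (@gkb_orthogonal i.+1 j.+1).
by rewrite dotNC; case: (@gkb_orthogonal j.+1 i.+1).
Qed.

(** Column i of A V, counted from 1, is alpha_i u_i + beta_(i+1) u_(i+1). Only the last column
    involves u_(p+1), which is either a column of U or has coefficient zero. *)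
Lemma gkb_AV q p : (p <= q)%N -> q = p.+1 \/ beta p.+1 = 0 ->
  A *m gkb_V v p = gkb_U q *m gkb_B alpha beta q p.
Proof.
move=> pq qp; apply/matrixP => l j.
have -> : (A *m gkb_V v p) l j = (A *m v j.+1) l 0.
  by rewrite !mxE; apply: eq_bigr => i _; rewrite !mxE.
rewrite gkb_AE // !mxE; under eq_bigr do rewrite mxE gkb_BE mulrDr.
rewrite big_split /= (sum_pick _ (fun i => u i.+1 l 0) (fun=> alpha j.+1)).
rewrite (sum_pick _ (fun i => u i.+1 l 0) (fun=> beta j.+2)).
rewrite (leq_trans (ltn_ord j) pq) addrC mulrC; congr (_ + _).
case: ltnP => [_|qj]; first by rewrite mulrC.
have jp : j.+1 = p by apply/eqP; rewrite eqn_leq ltn_ord (leq_trans pq).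
case: qp => [qp|]; first by move: qj; rewrite jp qp ltnn.
by rewrite -{1}jp => ->; rewrite mul0r.
Qed.

(* The last column of [N A^T M^-1 U] is the only one that can leave the span of
   [V], through its component [alpha (p+1) v (p+1)]. *)
Lemma gkb_ATU q p (r : 'cV[R]_q) : (q <= p.+1)%N ->
  (forall i : 'I_q, i = p :> nat -> alpha p.+1 = 0 \/ r i 0 = 0) ->
  N *m A^T *m invmx M *m (gkb_U q *m r) =
  gkb_V v p *m ((gkb_B alpha beta q p)^T *m r).
Proof.
move=> qp hr; apply/eqP; rewrite !mulmxA -subr_eq0 -mulmxBl.
apply/eqP/colP => l.
rewrite !mxE big1 // => i _; set K := N *m A^T *m invmx M.
have -> : (K *m gkb_U q - gkb_V v p *m (gkb_B alpha beta q p)^T) l i =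
          (if i == p :> nat then alpha p.+1 * v p.+1 l 0 else 0).
  have KE : (K *m gkb_U q) l i = (K *m u i.+1) l 0.
    by rewrite !mxE; apply: eq_bigr => k _; rewrite !mxE.
  rewrite mxE KE gkb_ATE // !mxE.
  under [X in _ - X]eq_bigr do
    rewrite [gkb_V _ _ _ _]mxE [_^T _ _]mxE gkb_BE mulrDr.
  rewrite big_split /=.
  under [X in _ - (X + _)]eq_bigr do rewrite eq_sym.
  rewrite (sum_pick _ (fun k => v k.+1 l 0) (fun k => alpha k.+1)).
  have -> : \sum_(k < p) v k.+1 l 0 *
              (if i == k.+1 :> nat then beta k.+2 else 0) = beta i.+1 * v i l 0.
    (* The first row of B has no subdiagonal entry, in agreement with v 0 = 0. *)
    case: {KE}i (ltn_ord i) => -[|i] hi /= iq.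
      by rewrite big1 ?(gkb_v0 hgkb) ?mxE ?mulr0 // => k _; rewrite mulr0.
    under eq_bigr do rewrite eqSS eq_sym.
    rewrite (sum_pick _ (fun k => v k.+1 l 0) (fun k => beta k.+2)).
    have -> : (i < p)%N by exact: (leq_trans iq qp).
    by rewrite mulrC.
  case: ltngtP => [ip|pi|->]; last by ring.
    by rewrite mulrC; ring.
  by have := leq_trans (ltn_ord i) qp; rewrite ltnS leqNgt pi.
case: eqP => [ip|_]; last by rewrite mul0r.
by case: (hr i ip) => ->; rewrite ?mul0r ?mulr0.
Qed.

End GolubKahanTheory.

(** * One projected Newton step, for abstract bases U and V *)

Lemma projJ_unit (R : realType) (beta1 lambda : R) q p (B : 'M[R]_(q, p)) y :
  0 < lambda -> B^T *m (B *m y - beta1 *: e1 q) != 0 ->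
  projJ beta1 B y lambda \in unitmx.
Proof.
move=> l0; rewrite /projJ; set r := _ - _ => g0.
apply: unitmx_inj_mul => z; rewrite -(vsubmxK z).
move: (usubmx z) (dsubmx z) => a s; rewrite (mx11_scalar s).
move: (s 0 0) => {z} {}s; rewrite mul_block_col mul0mx addr0 mul_mx_scalar.
rewrite -[0 in X in X -> _]col_mx0 => /eq_col_mx[E1 E2].
(* For (a, s) in the kernel, the second row says that a is orthogonal to g = B^T r. Pairing the
   first row with a then gives lambda |B a|^2 + |a|^2 = 0, so a = 0, and s g = 0 leaves s = 0. *)
have ga : bform 1%:M a (B^T *m r) = 0.
  by rewrite bformC ?trmx1 // bform1 trmx_mul trmxK E2 mxE.
have : bform 1%:M a ((lambda *: (B^T *m B) + 1%:M) *m a + s *: (B^T *m r)) = 0.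
  by rewrite E1 bform0r.
rewrite bformDr bformZr ga mulr0 addr0 mulmxDl mul1mx bformDr -scalemxAl.
rewrite bformZr {1}bform1 mulmxA mulmxA -trmx_mul -mulmxA -bform1 => h.
have a0 : a = 0.
  apply: (bform_eq0 (spd_id R p)); apply/eqP; rewrite eq_le bform_ge0 ?andbT //.
    rewrite -h lerDr; apply: mulr_ge0; first exact: ltW.
    by apply: bform_ge0; exact: spd_id.
  exact: spd_id.
move: E1; rewrite a0 mulmx0 add0r => /eqP; rewrite scaler_eq0 (negbTE g0) orbF.
by move/eqP=> ->; rewrite raddf0 col_mx0.
Qed.

Section ProjectedNewtonStep.
Context {R : realType} {m n q p : nat}.
Variables (A : 'M[R]_(m, n)) (b : 'cV[R]_m) (M : 'M[R]_m) (N : 'M[R]_n).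
Variable tau : R.
Hypotheses (hM : spd M) (hN : spd N).
Variables (U : 'M[R]_(m, q)) (V : 'M[R]_(n, p)) (B : 'M[R]_(q, p)).
Variables (beta1 : R) (y : 'cV[R]_p).
Let r := B *m y - beta1 *: e1 q.
Hypotheses (AV : A *m V = U *m B) (bU : b = U *m (beta1 *: e1 q)).
Hypotheses (gramU : U^T *m invmx M *m U = 1%:M).
Hypotheses (gramV : V^T *m invmx N *m V = 1%:M).
Hypothesis ATr : N *m A^T *m invmx M *m (U *m r) = V *m (B^T *m r).

Local Notation x := (V *m y).
Local Notation g := (B^T *m r).

Lemma proj_residual : A *m x - b = U *m r.
Proof. by rewrite mulmxA AV bU -mulmxA -mulmxBr. Qed.

Lemma proj_dot (z1 z2 : 'cV[R]_q) :
  bform (invmx M) (U *m z1) (U *m z2) = bform 1%:M z1 z2.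
Proof. by rewrite bform_mull !mulmxA -(mulmxA z1^T) -(mulmxA z1^T) gramU. Qed.

Lemma proj_discrepancy :
  discrepancy A b M tau x = 2^-1 * norm2 r ^+ 2 - tau * m%:R / 2.
Proof. by rewrite /discrepancy proj_residual proj_dot sqr_norm2. Qed.

Lemma proj_normal_residual : N *m normal_residual A b M x = V *m g.
Proof. by rewrite /normal_residual proj_residual -ATr !mulmxA. Qed.

Lemma proj_tr_normal_residual : V^T *m normal_residual A b M x = g.
Proof.
rewrite /normal_residual proj_residual !mulmxA -trmx_mul AV trmx_mul.
by rewrite -!mulmxA (mulmxA U^T) (mulmxA (U^T *m _)) gramU mul1mx.
Qed.

Lemma normal_residual_dot z : bform (invmx M) (A *m x - b) (A *m z) =
  (z^T *m normal_residual A b M x) 0 0.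
Proof.
rewrite bformC; last by case: (spd_inv hM).
by rewrite bform_mull.
Qed.

(* If [g = 0] then [x] solves the full least-squares problem, so its
   discrepancy is negative by assumption. *)
Lemma proj_gradient_neq0 : discrepancy_assumption A b M tau ->
  (tau * m%:R < bform (invmx M) b b -> 0 <= discrepancy A b M tau x) ->
  g != 0.
Proof.
move=> hdisc hd; apply/eqP => g0.
have s0 : normal_residual A b M x = 0.
  rewrite -[LHS]mul1mx -(mulVmx (spd_unit hN)) -mulmxA proj_normal_residual.
  by rewrite g0 !mulmx0.
have xmin z : wnorm (invmx M) (A *m x - b) <= wnorm (invmx M) (A *m z - b).
  have -> : A *m z - b = (A *m x - b) + 1 *: (A *m (z - x)).
    by rewrite -residual_shift scale1r subrK.
  (* As s = 0, the residual at x is orthogonal to A (z - x), and minimality follows by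
     Pythagoras. *)
  have := normal_residual_dot (z - x); rewrite s0 mulmx0 mxE.
  move: (A *m x - b) (A *m (z - x)) => e f ef0.
  rewrite !wnormE ler_wsqrtr // scale1r bformDr !bformDl (@bformC _ _ _ f e).
    by rewrite ef0 addr0 add0r lerDl bform_ge0 //; exact: spd_inv.
  by case: (spd_inv hM).
have [] := hdisc _ xmin; rewrite !(sqr_wnorm _ (spd_inv hM)) => lt1 /hd.
rewrite /discrepancy; lra.
Qed.

Variables (lambda dlambda : R) (dy : 'cV[R]_p).
Hypothesis Junit : projJ beta1 B y lambda \in unitmx.
Hypothesis direction : col_mx dy dlambda%:M =
  - (invmx (projJ beta1 B y lambda) *m projF tau beta1 m B y lambda).

Lemma proj_newton :
  lambda *: (B^T *m (B *m dy)) + dy + dlambda *: g = - (lambda *: g + y)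
  /\ bform 1%:M r (B *m dy) = - discrepancy A b M tau x.
Proof.
have : projJ beta1 B y lambda *m col_mx dy dlambda%:M
       = - projF tau beta1 m B y lambda.
  by rewrite direction mulmxN mulmxA mulmxV // mul1mx.
rewrite /projJ /projF -/r mul_block_col mul0mx addr0 mul_mx_scalar.
rewrite opp_col_mx => /eq_col_mx[E1 E2]; split.
  by rewrite -E1 mulmxDl mul1mx -scalemxAl mulmxA.
rewrite proj_discrepancy bform1 mulmxA E2.
by rewrite !mxE /= mulr1n.
Qed.

(** The second Newton equation is the linearization of d = 0, carried to the full space by A V = U B
    and the orthonormality of U. *)
Lemma proj_discrepancy_slope :
  bform (invmx M) (A *m x - b) (A *m (V *m dy)) = - discrepancy A b M tau x.
Proof.
by rewrite proj_residual mulmxA AV -mulmxA proj_dot; case: proj_newton.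
Qed.

(** Here d is quadratic, and its value after the step is exactly (1 - t) d + t^2 |A V dy|^2 / 2. *)
Lemma discrepancy_step_ge0 t : 0 <= t <= 1 ->
  0 <= discrepancy A b M tau x ->
  0 <= discrepancy A b M tau (x + t *: (V *m dy)).
Proof.
move=> /andP[t0 t1] d0; rewrite addrC discrepancy_shift //.
rewrite proj_discrepancy_slope.
have := bform_ge0 (A *m (V *m dy)) (spd_inv hM).
move: (bform _ _ _) (discrepancy _ _ _ _ _) d0 => e d d0 e0.
have : 0 <= t ^+ 2 * (2^-1 * e).
  by rewrite mulr_ge0 ?sqr_ge0 ?mulr_ge0 ?invr_ge0.
nra.
Qed.

Lemma proj_newton_slope :
  merit_slope A b M N tau x lambda (V *m dy) dlambda
  = - 2 * merit A b M N tau x lambda.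
Proof.
rewrite merit_slopeE // proj_discrepancy_slope meritE //.
set w := stationarity _ _ _ _ _ _.
set s := normal_residual A b M x.
have Nw : N *m w = V *m (lambda *: g + y).
  rewrite /w /stationarity mulmxDr -scalemxAr proj_normal_residual.
  by rewrite (mulmxA N) mulmxV ?spd_unit // mul1mx (mulmxDr V) -scalemxAr.
(* As N w lies in the range of V, pairing with w only sees V^T z. *)
have dotNw z : bform N w z = bform 1%:M (lambda *: g + y) (V^T *m z).
  have -> : bform N w z = ((N *m w)^T *m z) 0 0.
    by rewrite trmx_mul /bform; case: (hN) => ->.
  by rewrite Nw trmx_mul -mulmxA bform1.
rewrite !dotNw.
have -> : V^T *m w = lambda *: g + y.
  rewrite /w /stationarity (mulmxDr V^T) -scalemxAr proj_tr_normal_residual.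
  by rewrite !mulmxA gramV mul1mx.
(* Since V^T A^T M^-1 A V = B^T B, applying V^T turns the variation of w into the left side of the
   first Newton equation. *)
have -> : V^T *m (lambda *: (A^T *m invmx M *m (A *m (V *m dy)))
                  + invmx N *m (V *m dy) + dlambda *: s)
          = - (lambda *: g + y).
  case: proj_newton => <- _.
  rewrite !(mulmxDr V^T) -!scalemxAr proj_tr_normal_residual.
  rewrite !mulmxA gramV mul1mx -trmx_mul AV trmx_mul.
  rewrite -(mulmxA _ A V) AV -!mulmxA (mulmxA U^T) (mulmxA (U^T *m _)) gramU.
  by rewrite mul1mx.
rewrite -[- _ in LHS]scaleN1r bformZr.
by field.
Qed.

End ProjectedNewtonStep.

(** * The iteration and its invariant *)

Lemma gkb_V_pad (R : realType) n (v : nat -> 'cV[R]_n) p q (y : 'cV[R]_p) :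
  (p <= q)%N -> gkb_V v q *m pad q y = gkb_V v p *m y.
Proof.
move=> pq; apply/colP => l; rewrite !mxE.
pose F j := v j.+1 l 0 * (if insub j is Some j' then y j' 0 else 0).
rewrite (eq_bigr (fun i : 'I_q => F i)) => [|i _]; last by rewrite !mxE.
rewrite [RHS](eq_bigr (fun i : 'I_p => F i)) => [|i _]; last first.
  by rewrite /F mxE valK.
rewrite (big_ord_widen q F pq) [LHS](bigID (fun i : 'I_q => (i < p)%N)) /=.
rewrite [X in _ + X]big1 ?addr0 // => i ip.
by rewrite /F insubN // mulr0.
Qed.

(** If dlambda < 0, the cap in [gamma_init] gives gamma dlambda >= - eta lambda, so at least (1 -
    eta) lambda is left. *)
Lemma backtracking_bounds (R : realType) m n (A : 'M[R]_(m, n)) b M N tau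
    (c eta : R) x dx (lambda dlambda gamma : R) :
  0 < eta < 1 -> 0 < lambda ->
  backtracking A b M N tau c eta x dx lambda dlambda gamma ->
  0 <= gamma <= 1 /\ 0 < lambda + gamma * dlambda.
Proof.
move=> /andP[eta0 eta1] l0 [l [-> _ _]].
have : 0 < eta ^+ l <= 1 by rewrite exprn_gt0 // exprn_ile1 // ltW.
move: (eta ^+ l) => e /andP[e0 e1]; rewrite /gamma_init.
have [dl0|dl0] := leP 0 dlambda.
  by rewrite mulr1 e1 ltW //; split=> //; nra.
set g0 := Num.min _ _.
have g0_gt0 : 0 < g0.
  rewrite lt_min ltr01 mulNr mulNr -mulrN -invrN.
  by rewrite divr_gt0 ?mulr_gt0 ?oppr_gt0.
have g0_le1 : g0 <= 1 by rewrite ge_min lexx.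
have g0dl : - (eta * lambda) <= g0 * dlambda.
  rewrite -ler_ndivlMr // ge_min; apply/orP; right.
  by rewrite !mulNr.
split; first by apply/andP; split; nra.
(* Shrinking the step by e <= 1 only weakens the decrease of lambda. *)
have : 0 <= (1 - e) * (g0 * - dlambda).
  by rewrite !mulr_ge0 ?subr_ge0 ?oppr_ge0 ?(ltW g0_gt0) ?(ltW dl0).
nra.
Qed.

Section ProjectedNewtonIteration.
Context {R : realType} {m n : nat}.
Variables (A : 'M[R]_(m, n)) (b : 'cV[R]_m) (M : 'M[R]_m) (N : 'M[R]_n).
Variable tau : R.
Variables (u : nat -> 'cV[R]_m) (v : nat -> 'cV[R]_n) (alpha beta : nat -> R).
Variable kt : nat.
Hypotheses (hM : spd M) (hN : spd N).
Hypothesis hdisc : discrepancy_assumption A b M tau.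
Hypothesis hgkb : gen_GKB A b M N u v alpha beta.
Hypothesis hkt : gkb_terminates_at alpha beta kt.

Lemma gkb_beta_kt_neq0 i : (1 <= i <= kt)%N -> beta i != 0.
Proof.
case: hkt => kt1 ab _ hi; apply: (gkb_beta_neq0_le hM hN hgkb hi).
by apply: contraTneq ab => ->; rewrite mulr0 ltxx.
Qed.

Lemma gkb_alpha_kt_neq0 i : (1 <= i <= kt)%N -> alpha i != 0.
Proof.
case/andP=> i1; rewrite leq_eqVlt => /predU1P[->|ikt].
  case: hkt => kt1 ab _.
  by apply: contraTneq ab => ->; rewrite mul0r ltxx.
apply: (gkb_alpha_neq0 hM hgkb i1).
by apply: gkb_beta_kt_neq0; rewrite ikt.
Qed.

(** Otherwise beta_(kt+1) would be nonzero too, and the positive product would contradict the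
    maximality of kt. *)
Lemma gkb_alpha_ktS : alpha kt.+1 = 0.
Proof.
apply/eqP/negPn/negP => a0.
have b0 := gkb_beta_neq0 hN hgkb (isT : (1 <= kt.+1)%N) a0.
suff ab : 0 < alpha kt.+1 * beta kt.+1.
  by case: hkt => _ _ /(_ kt.+1 isT ab); rewrite ltnn.
rewrite mulr_gt0 // lt_def ?a0 ?b0 /=.
  exact: (gkb_alpha_ge0 hgkb).
exact: (gkb_beta_ge0 hgkb).
Qed.

Section Iteration.
Variable k : nat.
Hypothesis k1 : (1 <= k)%N.
Local Notation p := (gkb_cols kt k).
Local Notation q := (gkb_rows beta kt k).
Local Notation U := (gkb_U u q).
Local Notation V := (gkb_V v p).
Local Notation B := (gkb_B alpha beta q p).

Lemma gkb_cols_le : (p <= kt)%N.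
Proof. exact: geq_minr. Qed.

Lemma gkb_rows_bounds : (p <= q <= p.+1)%N /\ (q = p.+1 \/ beta p.+1 = 0).
Proof.
rewrite /gkb_rows; case: ifP => [/andP[ktk /eqP b0]|_].
  by rewrite /gkb_cols (minn_idPr ktk) leqnn leqnSn b0; split=> //; right.
by rewrite leqnSn leqnn; split=> //; left.
Qed.

Lemma gkb_rows_gt0 : (0 < q)%N.
Proof.
case: hkt => kt1 _ _; have [/andP[pq _] _] := gkb_rows_bounds.
by apply: leq_trans pq; rewrite leq_min k1.
Qed.

(** At most kt + 1 rows occur, and row kt + 1 is kept only if beta_(kt+1) is nonzero; all earlier
    coefficients are nonzero by the choice of kt. *)
Lemma gkb_beta_rows_neq0 i : (1 <= i <= q)%N -> beta i != 0.
Proof.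
case/andP=> i1; rewrite /gkb_rows; case: ifP => [_ ikt|kb].
  by apply: gkb_beta_kt_neq0; rewrite i1.
have := gkb_cols_le; rewrite leq_eqVlt => /predU1P[pkt|pkt] ip.
  have ktk : (kt <= k)%N by rewrite -pkt geq_minl.
  move: ip; rewrite pkt leq_eqVlt => /predU1P[->|ikt].
    by move: kb; rewrite ktk /= => ->.
  by apply: gkb_beta_kt_neq0; rewrite i1.
by apply: gkb_beta_kt_neq0; rewrite i1 (leq_trans ip).
Qed.

Lemma gkb_initU : b = U *m (beta 1%N *: e1 q).
Proof.
rewrite -scalemxAr -(gkb_init hgkb); congr (_ *: _).
have -> : e1 q = delta_mx (Ordinal gkb_rows_gt0) 0 :> 'cV[R]_q.
  by apply/colP => i; rewrite !mxE eqxx andbT.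
by rewrite -colE col_gkb_U.
Qed.

Variable y : forall k, 'cV[R]_(gkb_cols kt k).
Local Notation ybar := (pnt_ybar y k).

Lemma gkb_cols_pred_le : (gkb_cols kt k.-1 <= p)%N.
Proof. by rewrite leq_min geq_minr (leq_trans (geq_minl _ _) (leq_pred _)). Qed.

Lemma pnt_x_pred : pnt_x v y k.-1 = V *m ybar.
Proof. by rewrite /pnt_ybar gkb_V_pad ?gkb_cols_pred_le. Qed.

Lemma pnt_last_residual (i : 'I_q) : i = p :> nat ->
  alpha p.+1 = 0 \/ (B *m ybar - beta 1%N *: e1 q) i 0 = 0.
Proof.
move=> ip; have [ktk|kkt] := leqP kt k.
  by left; rewrite /gkb_cols (minn_idPr ktk) gkb_alpha_ktS.
have pk : p = k by rewrite /gkb_cols (minn_idPl (ltnW kkt)).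
have i0 : (i == 0 :> nat) = false by rewrite ip [in LHS]pk gtn_eqF.
right; rewrite !mxE i0 mulr0 subr0.
(* In 0-based row p, only the last column of B can be nonzero, and it meets the zero appended to
   y. *)
rewrite big1 // => j _; rewrite gkb_BE ip [in p == _]gtn_eqF ?ltn_ord // add0r.
case: eqP => [pj|_]; last by rewrite mul0r.
rewrite mxE insubN ?mulr0 // -leqNgt.
have kj : k.-1 = j := congr1 predn (etrans (esym pk) pj).
by rewrite -kj geq_minl.
Qed.

Lemma pnt_AV : A *m V = U *m B.
Proof. by have [/andP[pq _] qp] := gkb_rows_bounds; exact: (gkb_AV hgkb). Qed.

Lemma pnt_gramU : U^T *m invmx M *m U = 1%:M.
Proof. exact: (gkb_gramU hM hN hgkb gkb_beta_rows_neq0). Qed.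

Lemma pnt_gramV : V^T *m invmx N *m V = 1%:M.
Proof.
apply: (gkb_gramV hM hN hgkb) => i /andP[i1 ip].
by apply: gkb_alpha_kt_neq0; rewrite i1 (leq_trans ip) ?gkb_cols_le.
Qed.

Lemma pnt_ATr : let r := B *m ybar - beta 1%N *: e1 q in
  N *m A^T *m invmx M *m (U *m r) = V *m (B^T *m r).
Proof.
have [/andP[_ qp] _] := gkb_rows_bounds.
exact: (gkb_ATU hgkb qp pnt_last_residual).
Qed.

Lemma pnt_projJ_unit lambda : 0 < lambda ->
  (tau * m%:R < bform (invmx M) b b ->
     0 <= discrepancy A b M tau (pnt_x v y k.-1)) ->
  projJ (beta 1%N) B ybar lambda \in unitmx.
Proof.
rewrite pnt_x_pred => l0 hd; apply: (projJ_unit l0).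
exact: (proj_gradient_neq0 hM hN pnt_AV gkb_initU pnt_ATr hdisc hd).
Qed.

End Iteration.

Variables (c eta lambda0 : R) (y dy : forall k, 'cV[R]_(gkb_cols kt k)).
Variables (lambda dlambda gamma : nat -> R) (K : nat).
Hypotheses (heta : 0 < eta < 1) (hlambda0 : 0 < lambda0).
Hypothesis hrun : PNT_run A b M N tau c eta lambda0 v alpha beta y dy
  lambda dlambda gamma K.

(* The discrepancy is convex in [x] and its linearization vanishes at the full
   Newton step, so damped steps keep it nonnegative. *)
Lemma pnt_invariant k : (k < K)%N ->
  0 < lambda k /\ (tau * m%:R < bform (invmx M) b b ->
                   0 <= discrepancy A b M tau (pnt_x v y k)).
Proof.
elim: k => [|k IH] kK.
  (* The standing assumption yields tau m < |b|^2 only once a minimizer is at hand, so this bound is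
     carried as a premise. At x = 0 it says d > 0. *)
  rewrite (pnt_lambda0 hrun); split=> // hb.
  have -> : pnt_x v y 0 = 0.
    apply/colP => l; rewrite !mxE big1 // => i _.
    by have := leq_trans (ltn_ord i) (geq_minl _ _).
  rewrite /discrepancy mulmx0 add0r -scaleN1r bformZl bformZr; lra.
have [l0 hd] := IH (ltnW kK).
(* The invariant at k makes J nonsingular at iteration k + 1, so the direction there solves the
   Newton system. *)
have Ju := @pnt_projJ_unit k.+1 isT y _ l0 hd.
have dirk := pnt_direction hrun (ltnW kK : (1 <= k.+1 <= K)%N).
have gam := pnt_gamma hrun (kK : (1 <= k.+1 < K)%N).
have [g01 l1] := backtracking_bounds heta l0 gam.
rewrite (pnt_lambda hrun) //; split=> // hb.
have -> : pnt_x v y k.+1 = pnt_x v y k + gamma k.+1 *: pnt_dx v dy k.+1.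
  rewrite /pnt_x (pnt_y hrun) // mulmxDr -scalemxAr.
  by rewrite -(@pnt_x_pred k.+1).
have := hd hb; rewrite (@pnt_x_pred k.+1).
exact: (discrepancy_step_ge0 hM (pnt_AV k.+1) (@gkb_initU k.+1 isT)
  (pnt_gramU k.+1) Ju dirk g01).
Qed.

End ProjectedNewtonIteration.

Theorem theorem3p4 (R : realType) (m n : nat) (hm : (1 <= m)%N) (hn : (1 <= n)%N)
  (A : 'M[R]_(m, n)) (b : 'cV[R]_m) (M : 'M[R]_m) (N : 'M[R]_n)
  (hM : spd M) (hN : spd N) (tau : R) (htau : 1 < tau)
  (hdisc : discrepancy_assumption A b M tau)
  (u : nat -> 'cV[R]_m) (v : nat -> 'cV[R]_n) (alpha beta : nat -> R)
  (hgkb : gen_GKB A b M N u v alpha beta)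
  (kt : nat) (hkt : gkb_terminates_at alpha beta kt)
  (c eta lambda0 : R) (hc : 0 < c < 1) (heta : 0 < eta < 1)
  (hlambda0 : 0 < lambda0)
  (y dy : forall k : nat, 'cV[R]_(gkb_cols kt k))
  (lambda dlambda gamma : nat -> R)
  (k : nat) (hk : (1 <= k)%N)
  (hrun : PNT_run A b M N tau c eta lambda0 v alpha beta y dy
            lambda dlambda gamma k) :
  let x := pnt_x v y k.-1 in
  let h := merit A b M N tau x (lambda k.-1) in
  ((grad_merit A b M N tau x (lambda k.-1))^T
     *m col_mx (pnt_dx v dy k) (dlambda k)%:M) 0 0 = - 2 * h
  /\ - 2 * h <= 0.
Proof.
move=> x h; split; last first.
  by rewrite mulNr oppr_le0 mulr_ge0 // merit_ge0.
have k1k : (k.-1 < k)%N by rewrite prednK.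
have [l0 hd] := pnt_invariant hM hN hdisc hgkb hkt heta hlambda0 hrun k1k.
have Ju := pnt_projJ_unit hM hN hdisc hgkb hkt hk l0 hd.
have kk : (1 <= k <= k)%N by rewrite hk leqnn.
have dirk := pnt_direction hrun kk.
rewrite /h /x (pnt_x_pred v k y).
exact: (proj_newton_slope hM hN (pnt_AV kt hgkb k) (gkb_initU hgkb hkt hk)
  (pnt_gramU hM hN hgkb hkt k) (pnt_gramV hM hN hgkb hkt k)
  (pnt_ATr hN hgkb hkt hk y) Ju dirk).
Qed.
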